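(* Let $\mathbb{V}$ be a vector space of dimension $n$ over a field $\mathbb{F}$ with $q$ elements, and let $\Gamma(\mathbb{V})$ be its non-zero component graph with respect to a basis $\{b_1,\ldots,b_n\}$. If $q=2$ and $n>3$, then the exchange property does not hold for locating-dominating sets in $\Gamma(\mathbb{V})$.
   Context: Non-zero component graph: given a finite-dimensional vector space $\mathbb{V}$ over $\mathbb{F}$ with basis $\{b_1,\ldots,b_n\}$, $\Gamma(\mathbb{V})$ is the simple graph whose vertices are the non-zero vectors of $\mathbb{V}$; two distinct vertices are adjacent if and only if there is some $b_i$ that has non-zero coefficient in the unique linear combinations (with respect to the basis) of both. For a graph $\Gamma$ and a vertex $u$, $N(u)$ is the set of vertices adjacent to $u$. A set $L_D\subseteq V(\Gamma)$ is a locating-dominating set for $\Gamma$ if for every two distinct vertices $u,v\in V(\Gamma)\setminus L_D$ we have $\emptyset\ne N(u)\cap L_D\ne N(v)\cap L_D\ne\emptyset$ (i.e. both intersections are non-empty and they are different from each other). A locating-dominating set is minimal if it is minimal with respect to inclusion among locating-dominating sets. Exchange property: locating-dominating sets have the exchange property in $\Gamma$ if whenever $L_{D_1}$ and $L_{D_2}$ are minimal locating-dominating sets for $\Gamma$ and $u_1\in L_{D_1}$, there exists $u_2\in L_{D_2}$ such that $(L_{D_2}\setminus\{u_2\})\cup\{u_1\}$ is also a minimal locating-dominating set. *)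

(* Defs.v *)
From HB Require Import structures.
From mathcomp Require Import all_boot all_order all_algebra.
From mathcomp Require Import boolp classical_sets.

Set Implicit Arguments.
Unset Strict Implicit.
Unset Printing Implicit Defensive.

Import GRing.Theory.

Local Open Scope ring_scope.
Local Open Scope classical_set_scope.

Record sgraph := SGraph {
  vertex :> Type;
  adj : rel vertex;
  adj_sym : symmetric adj;
  adj_irrefl : irreflexive adj }.

Section LocatingDominating.
Variable G : sgraph.
Implicit Types (u v : G) (L : set G).

Definition neighbors u : set G := [set v | adj u v].

Definition locating_dominating L : Prop :=
  forall u v, ~ L u -> ~ L v -> u <> v ->
    [/\ neighbors u `&` L !=set0,
        neighbors u `&` L <> neighbors v `&` L &
        neighbors v `&` L !=set0].

Definition minimal_locating_dominating L : Prop :=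
  locating_dominating L /\
  forall L', locating_dominating L' -> L' `<=` L -> L' = L.

Definition ld_exchange_property : Prop :=
  forall L1 L2,
    minimal_locating_dominating L1 -> minimal_locating_dominating L2 ->
  forall u1, L1 u1 ->
  exists u2, L2 u2 /\
    minimal_locating_dominating ((L2 `\` [set u2]) `|` [set u1]).

End LocatingDominating.

Section NonZeroComponentGraph.
Variables (F : fieldType) (V : vectType F) (n : nat) (b : n.-tuple V).

Definition nz_vector := {v : V | v != 0}.

(* coord b i v is the coefficient of b_i in v only when b is a basis; *)
(* this is a hypothesis wherever the graph is used.                   *)
Definition nzc_adj : rel nz_vector := fun u v =>
  (u != v) &&
  [exists i : 'I_n, (coord b i (val u) != 0) && (coord b i (val v) != 0)].

Lemma nzc_adj_sym : symmetric nzc_adj.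
Proof.
move=> u v; rewrite /nzc_adj eq_sym; congr (_ && _).
by apply: eq_existsb => i; rewrite andbC.
Qed.

Lemma nzc_adj_irrefl : irreflexive nzc_adj.
Proof. by move=> u; rewrite /nzc_adj eqxx. Qed.

Definition nz_component_graph : sgraph := SGraph nzc_adj_sym nzc_adj_irrefl.

End NonZeroComponentGraph.

(* Main.v *)
Require Import Defs.
From mathcomp Require Import all_boot all_order all_algebra.
From mathcomp Require Import boolp classical_sets.

(** Over the field with two elements a vertex is a nonempty subset of the index
set (its support), and adjacency of distinct vertices means intersecting. The
basis B is a minimal locating-dominating set. Deleting one basis vector b_i from
the whole vertex set leaves a (vacuously) locating-dominating set, which contains
a minimal one M; since b_i has to be dominated, M is not a subset of B, so it has
an element u with support of size at least two. No exchange
(B \ {b_i}) U {u} is locating-dominating: if i is not in supp u then b_i is not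
dominated; otherwise take j <> i in supp u and k such that {i,j,k} <> supp u: the
vertices {j,k} and {i,j,k} have the same neighbours in the exchanged set. *)

Set Implicit Arguments.
Unset Strict Implicit.
Unset Printing Implicit Defensive.

Import GRing.Theory.

(** The injection into [T] makes the vertex set finite, so a locating-dominating subset of [L] whose
    image has least cardinality exists, and it is minimal for inclusion. *)
Lemma minimal_locating_dominating_sub (G : sgraph) (T : finType) (f : G -> T)
    (L : set G) :
  injective f -> locating_dominating L ->
  exists2 M, minimal_locating_dominating M & (M `<=` L)%classic.
Proof.
move=> f_inj ldL.
pose img (M : set G) := finset (fun x : T => `[< exists2 v, M v & f v = x >]).
pose P k := `[< exists M, [/\ locating_dominating M, (M `<=` L)%classic
                           & #|img M| = k] >].
have exP : exists k, P k by exists #|img L|; apply/asboolP; exists L; split.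
case: (ex_minnP exP) => k /asboolP[M [ldM subML cardM]] min_k.
exists M => //; split=> // M' ldM' subM'M.
have le_k : k <= #|img M'|.
  by apply: min_k; apply/asboolP; exists M'; split=> // v /subM'M /subML.
have sub_img : img M' \subset img M.
  apply/fintype.subsetP => x; rewrite !inE => -[v M'v <-].
  by exists v => //; apply: subM'M.
have /eqP eq_img : img M' == img M by rewrite eqEcard sub_img cardM.
apply/seteqP; split=> // v Mv.
have : f v \in img M by rewrite inE; apply/asboolP; exists v.
by rewrite -eq_img inE => /asboolP[w M'w /f_inj <-].
Qed.

Section IntersectionGraph.
Local Open Scope classical_set_scope.
Variables (G : sgraph) (T : finType) (supp : G -> {set T}).
Hypothesis supp_inj : injective supp.
Hypothesis supp_neq0 : forall v, exists i, i \in supp v.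
Hypothesis supp_surj : forall (A : {set T}) i, i \in A -> exists v, supp v = A.
Hypothesis adjP : forall u v : G,
  adj u v <-> u <> v /\ exists i, i \in supp u /\ i \in supp v.
Hypothesis cardT : 3 < #|T|.

Let atoms : set G := [set v | exists i, supp v = finset.set1 i].

Lemma exists_notin3 (i j k : T) : exists l, [/\ l <> i, l <> j & l <> k].
Proof.
have : 0 < #|~: [set i; j; k]%SET|.
  rewrite -(ltn_add2l #|[set i; j; k]%SET|) cardsC addn0.
  apply: leq_ltn_trans cardT.
  apply: (leq_trans (leq_card_setU _ _)).
  by rewrite cards1 cards2; case: (_ != _).
case/card_gt0P => l; rewrite !inE !negb_or => /andP[/andP[/eqP li /eqP lj] /eqP lk].
by exists l.
Qed.

(** If [L] missed [i], the vertices with supports [{i}] and [T] would both lie outside [L], and any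
    neighbour dominating the first contains [i]. The second vertex is there because domination is
    only asserted for pairs of distinct vertices outside [L]. *)
Lemma locating_dominating_cover (L : set G) i :
  locating_dominating L -> exists2 w, L w & i \in supp w.
Proof.
move=> ldL; apply: contrapT => noL.
have notL v : i \in supp v -> ~ L v by move=> iv Lv; apply: noL; exists v.
have [u su] : exists u, supp u = finset.set1 i.
  by apply: (@supp_surj _ i); rewrite inE.
have [v sv] : exists v, supp v = finset.setTfor T.
  by apply: (@supp_surj _ i); rewrite inE.
have [j [ji _ _]] := exists_notin3 i i i.
have uv : u <> v.
  move=> uv; have : j \in supp u by rewrite uv sv inE.
  by rewrite su inE => /eqP.
have iu : i \in supp u by rewrite su inE.
have iv : i \in supp v by rewrite sv inE.
have [[w [/adjP[_ [l]]]]] := ldL u v (notL _ iu) (notL _ iv) uv.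
by rewrite su inE => -[/eqP ->] iw Lw; case: (notL w).
Qed.

Lemma atoms_minimal : minimal_locating_dominating atoms.
Proof.
have dom u : ~ atoms u -> neighbors u `&` atoms !=set0.
  move=> nu; have [i iu] := supp_neq0 u.
  have [e se] : exists e, supp e = finset.set1 i.
    by apply: (@supp_surj _ i); rewrite inE.
  have ae : atoms e by exists i.
  exists e; split=> //; apply/adjP; split; first by move=> ue; rewrite ue in nu.
  by exists i; rewrite se inE.
have sep u v : ~ atoms u -> ~ atoms v ->
    neighbors u `&` atoms = neighbors v `&` atoms -> supp u \subset supp v.
  move=> nu nv eqN; apply/fintype.subsetP => i iu.
  have [e se] : exists e, supp e = finset.set1 i.
    by apply: (@supp_surj _ i); rewrite inE.
  have ae : atoms e by exists i.
  have : (neighbors u `&` atoms) e.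
    split=> //; apply/adjP; split; first by move=> ue; rewrite ue in nu.
    by exists i; rewrite se inE.
  by rewrite eqN => -[/adjP[_ [l []]]]; rewrite se inE => lv /eqP <-.
split=> [u v nu nv uv|L' ldL' subL'].
  split; [exact: dom| |exact: dom].
  move=> eqN; apply: uv; apply: supp_inj; apply/eqP.
  by rewrite finset.eqEsubset !sep.
apply/seteqP; split=> // v [i sv].
have [w L'w] := locating_dominating_cover i ldL'.
have [j sw] := subL' w L'w; rewrite sw inE => /eqP ij.
by rewrite (_ : v = w) //; apply: supp_inj; rewrite sv sw ij.
Qed.

Lemma atoms_exchangeN u e : ~ atoms u -> atoms e ->
  ~ locating_dominating ((atoms `\` [set e]) `|` [set u]).
Proof.
move=> nu [i se] ldL.
have iu : i \in supp u.
  have [w [[[j sw] we]|-> //]] := locating_dominating_cover i ldL.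
  rewrite sw inE => /eqP ij; case: we; apply: supp_inj.
  by rewrite sw se ij.
have [j ju ji] : exists2 j, j \in supp u & j <> i.
  apply: contrapT => noj; apply: nu; exists i; apply/setP => j.
  rewrite inE; apply/idP/eqP => [ju|-> //].
  by apply: contrapT => ji; apply: noj; exists j.
have [k [ki kj sk]] : exists k, [/\ k <> i, k <> j & supp u <> [set i; j; k]%SET].
  (* If [{i,j,k}] happens to be [supp u], a fourth index [l] replaces [k]. *)
  have [k [ki kj _]] := exists_notin3 i j i.
  have [l [li lj lk]] := exists_notin3 i j k.
  case: (pselect (supp u = [set i; j; k]%SET)) => [su|nsu]; last by exists k.
  exists l; split=> // su'; have : l \in supp u by rewrite su' !inE eqxx !orbT.
  by rewrite su !inE => /orP[/orP[]|] /eqP.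
have [x sx] : exists x, supp x = [set j; k]%SET.
  by apply: (@supp_surj _ j); rewrite !inE eqxx.
have [y sy] : exists y, supp y = [set i; j; k]%SET.
  by apply: (@supp_surj _ i); rewrite !inE eqxx.
have ix : i \notin supp x.
  by rewrite sx !inE negb_or; apply/andP; split; apply/eqP => /esym.
have natom z : j \in supp z -> k \in supp z -> ~ atoms z.
  by move=> jz kz [l sz]; move: jz kz; rewrite sz !inE => /eqP <- /eqP.
have nx : ~ ((atoms `\` [set e]) `|` [set u]) x.
  case=> [[ax _]|xu]; last by move: ix; rewrite xu iu.
  by apply: natom ax; rewrite sx !inE eqxx ?orbT.
have ny : ~ ((atoms `\` [set e]) `|` [set u]) y.
  case=> [[ay _]|yu]; last by apply: sk; rewrite -yu.
  by apply: natom ay; rewrite sy !inE eqxx ?orbT.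
have xy : x <> y by move=> xy; move: ix; rewrite xy sy !inE eqxx.
have [_ neqN _] := ldL x y nx ny xy; apply: neqN.
apply/seteqP; split=> w [/adjP[_ [l [lx lw]]] Lw]; split=> //; apply/adjP.
- split; first by move=> yw; apply: ny; rewrite yw.
  by exists l; split=> //; move: lx; rewrite sx sy !inE -orbA => ->; rewrite orbT.
- split; first by move=> xw; apply: nx; rewrite xw.
  (* The supports of [x] and [y] differ only in [i]. The one atom that could tell them apart is [e],
     which was removed, and [u] meets both in [j]. *)
  case: Lw => [[[m sw] we]|->]; last by exists j; rewrite sx !inE eqxx.
  exists l; split=> //; move: lx; rewrite sx sy !inE -orbA => /orP[/eqP li|//].
  case: we; apply: supp_inj; rewrite sw se; move: lw.
  by rewrite sw li inE => /eqP ->.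
Qed.

Lemma intersection_graph_exchangeN : ~ ld_exchange_property G.
Proof.
move=> exG.
have [i _] : exists i : T, i \in T by apply/card_gt0P; apply: ltn_trans cardT.
have [e se] : exists e, supp e = finset.set1 i.
  by apply: (@supp_surj _ i); rewrite inE.
have ldCe : locating_dominating (~` [set e]).
  by move=> u v /contrapT -> /contrapT ->.
have [M minM subM] := minimal_locating_dominating_sub supp_inj ldCe.
have [u Mu iu] := locating_dominating_cover i minM.1.
(* The only atom containing [i] is [e], which [M] avoids. *)
have nu : ~ atoms u.
  case=> j su; apply: (subM u Mu); apply: supp_inj.
  by move: iu; rewrite su se inE => /eqP ->.
have [e' [ae' [ld _]]] := exG M atoms minM atoms_minimal u Mu.
exact: atoms_exchangeN ae' ld.
Qed.

End IntersectionGraph.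

Lemma card2_neq0 (F : finFieldType) (x : F) : #|F| = 2 -> (x != 0)%R -> (x = 1)%R.
Proof.
move=> cardF x0; apply/eqP; apply: contraT => x1.
have : #|[set 0%R; 1%R; x]%SET| <= #|F| by apply: max_card.
by rewrite -finset.setUA cardsU1 cards2 !inE negb_or eq_sym oner_eq0 eq_sym x0 eq_sym x1 cardF.
Qed.

Theorem lemma2p12 (q n : nat) (F : finFieldType) (V : vectType F)
    (b : n.-tuple V) (hq : #|F| = q) (hdim : \dim (fullv : {vspace V}) = n)
    (hb : basis_of (fullv : {vspace V}) b) (hq2 : q = 2) (hn : 3 < n) :
  ~ ld_exchange_property (nz_component_graph b).
Proof.
have cardF : #|F| = 2 by rewrite hq.
have coordK v : v = (\sum_i coord b i v *: b`_i)%R.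
  by apply: coord_basis hb _; rewrite memvf.
pose supp (v : nz_component_graph b) :=
  [set i | coord b i (val (v : nz_vector V)) != 0%R]%SET.
apply: (@intersection_graph_exchangeN _ _ supp); last by rewrite card_ord.
(* Nonzero coefficients all equal 1, so the support determines the vector. *)
- move=> u v suv; apply/val_inj; rewrite (coordK (val u)) (coordK (val v)).
  apply: eq_bigr => i _; congr (_ *: _)%R.
  have : (i \in supp u) = (i \in supp v) by rewrite suv.
  rewrite !inE; case: (eqVneq (coord b i (val u)) 0%R) => [->|u0] /esym.
    by move/negbFE/eqP.
  by move=> v0; rewrite (card2_neq0 cardF u0) (card2_neq0 cardF v0).
- move=> v; apply: contrapT => nov; case/eqP: (svalP v).
  rewrite (coordK (val v)) big1 // => i _.
  case: (eqVneq (coord b i (val v)) 0%R) => [->|v0]; first by rewrite scale0r.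
  by case: nov; exists i; rewrite inE.
(* The sum of the basis vectors indexed by [A] has support [A]; its coefficient 1 at [i] makes it a
   vertex. *)
- move=> A i iA; pose v := (\sum_j (j \in A)%:R *: b`_j)%R.
  have cv j : coord b j v = (j \in A)%:R%R.
    by rewrite coord_sum_free // (basis_free hb).
  have v0 : (v != 0)%R.
    apply/eqP => v0; have := cv i; rewrite v0 linear0 iA => /eqP.
    by rewrite eq_sym oner_eq0.
  exists (exist _ v v0); apply/setP => j; rewrite inE /= cv.
  by case: (j \in A); rewrite ?oner_eq0 ?eqxx.
- move=> u v; split.
    move=> /andP[/eqP uv /existsP[i /andP[ui vi]]]; split=> //.
    by exists i; rewrite !inE.
  move=> [uv [i]]; rewrite !inE => -[ui vi]; apply/andP; split; first exact/eqP.
  by apply/existsP; exists i; rewrite ui.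
Qed.
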